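(* Let $b\ge 2$ be an integer. If $b\equiv 3\pmod 4$, then there are no strict pandigital oblong numbers in base $b$ and no strict penholodigital oblong numbers in base $b$.
   Context: An oblong (pronic) number is a number of the form $m(m+1)$ with $m$ an integer. Numbers are written in base $b$ without leading zeros, with digits $0,1,\dots,b-1$. A positive integer $N$ is a strict pandigital number in base $b$ if its base-$b$ representation contains each of the $b$ digits $0,1,\dots,b-1$ exactly once. $N$ is a strict penholodigital number in base $b$ if its base-$b$ representation does not contain the digit $0$ and contains each of the $b-1$ nonzero digits $1,\dots,b-1$ exactly once. *)

(* Defs.v *)
From mathcomp Require Import all_boot all_order all_algebra.

Set Implicit Arguments.
Unset Strict Implicit.
Unset Printing Implicit Defensive.

(* For 1 < b and 0 < N, the digits of N in base b without leading zeros, least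
   significant digit first; trunc_log b N is the exponent of the largest power
   of b not exceeding N.  See digitsP and digits_unique. *)
Definition digits (b N : nat) : seq nat :=
  [seq (N %/ b ^ i) %% b | i <- iota 0 (trunc_log b N).+1].

Definition oblong (N : nat) : Prop :=
  exists m : int, (N%:Z = m * (m + 1))%R.

Definition strict_pandigital (b N : nat) : Prop :=
  0 < N /\ (forall d : nat, d < b -> count_mem d (digits b N) = 1).

Definition strict_penholodigital (b N : nat) : Prop :=
  [/\ 0 < N,
      0 \notin digits b N
    & forall d : nat, 0 < d < b -> count_mem d (digits b N) = 1].

Definition is_base_repr (b N : nat) (s : seq nat) : Prop :=
  [/\ all (fun d => d < b) s,
      0 < last 0 s
    & N = \sum_(i < size s) nth 0 s i * b ^ i].

Lemma digitsP (b N : nat) : 1 < b -> 0 < N -> is_base_repr b N (digits b N).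
Proof.
move=> b1 N0; have b0 := ltnW b1; have /andP[lo hi] := trunc_log_bounds b1 N0.
split.
- by apply/allP => d /mapP[i _ ->]; rewrite ltn_pmod.
- rewrite /digits -[(trunc_log b N).+1]addn1 iotaD map_cat last_cat /= add0n modn_small.
    by rewrite divn_gt0 // expn_gt0 b0.
  by rewrite ltn_divLR ?expn_gt0 ?b0 // -expnS.
rewrite size_map size_iota.
have -> : \sum_(i < (trunc_log b N).+1) nth 0 (digits b N) i * b ^ i
        = \sum_(i < (trunc_log b N).+1) (N %/ b ^ i) %% b * b ^ i.
  apply: eq_bigr => i _.
  by rewrite (nth_map 0) ?size_iota ?ltn_ord // nth_iota ?ltn_ord // add0n.
have E k : N = N %/ b ^ k * b ^ k + \sum_(i < k) (N %/ b ^ i) %% b * b ^ i.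
  elim: k => [|k IH]; first by rewrite big_ord0 expn0 divn1 muln1 addn0.
  rewrite big_ord_recr /= [X in _ + X]addnC addnA expnSr divnMA.
  by rewrite mulnA mulnAC -mulnDl -divn_eq -IH.
by rewrite {1}(E (trunc_log b N).+1) divn_small.
Qed.

Lemma digits_unique (b N : nat) (s : seq nat) :
  1 < b -> 0 < N -> is_base_repr b N s -> s = digits b N.
Proof.
move=> b1 N0 Hs; have := digitsP b1 N0; have b0 := ltnW b1.
move: (digits b N) Hs => t; elim: s t N {N0} => [|x s IH] t N; first by case.
move=> [] /= /andP[xb sb] ls ->; case: t => [|y t]; first by case.
move=> [] /= /andP[yb tb] lt; rewrite !big_ord_recl /= !muln1.
have F (u : seq nat) : \sum_(i < size u) nth 0 u i * b ^ i.+1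
    = (\sum_(i < size u) nth 0 u i * b ^ i) * b.
  by rewrite big_distrl; apply: eq_bigr => i _; rewrite expnSr mulnA.
have G (u : seq nat) : 0 < last 0 u -> 0 < \sum_(i < size u) nth 0 u i * b ^ i.
  case: u => // a u lu; rewrite big_ord_recr /= addn_gt0.
  by rewrite (nth_last 0 (a :: u)) muln_gt0 lu expn_gt0 b0 orbT.
rewrite /bump /= !F => E.
have Exy : x = y.
  have := congr1 (modn^~ b) E.
  by rewrite /= ![_ + _ * b]addnC !modnMDl !modn_small.
move: E; rewrite Exy => /addnI /eqP; rewrite eqn_pmul2r // => /eqP E.
congr cons; case: s IH sb ls E => [|a s] IH sb ls E.
  case: t tb lt E => // c t tb lt E.
  by have := G (c :: t) lt; rewrite -E big_ord0.
case: t tb lt E => [|c t] tb lt E.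
  by have := G (a :: s) ls; rewrite E big_ord0.
by apply: (IH (c :: t) (\sum_(i < size (a :: s)) nth 0 (a :: s) i * b ^ i)).
Qed.

(* Main.v *)
Require Import Defs.
From mathcomp Require Import all_boot all_order all_algebra.
From mathcomp Require Import zify.

(** For odd [b] a number has the parity of its base-[b] digit sum. In both the
    pandigital and the penholodigital case that sum is [b (b - 1) / 2], which is
    odd when [b] is 3 modulo 4, whereas [m (m + 1)] is always even. *)

Lemma oblong_even (N : nat) : oblong N -> ~~ odd N.
Proof.
(* Both signs give the same product: [Negz n] is [-(n + 1)], and
   [(-(n + 1)) * (-n) = n * (n + 1)]. *)
case=> -[] n hN; have -> : N = n * n.+1 by lia.
  by rewrite oddM /= andbN.
by rewrite oddM /= andbN.
Qed.

Lemma odd_sum (I : Type) (r : seq I) (P : pred I) (F : I -> nat) :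
  odd (\sum_(i <- r | P i) F i) = \big[addb/false]_(i <- r | P i) odd (F i).
Proof. exact: (big_morph odd oddD). Qed.

(** Powers of an odd [b] are odd, so each term of the expansion has the parity of its digit. *)
Lemma odd_base_repr (b N : nat) (s : seq nat) :
  odd b -> is_base_repr b N s -> odd N = odd (sumn s).
Proof.
move=> ob [_ _ ->]; rewrite sumnE (big_nth 0) big_mkord !odd_sum.
by apply: eq_bigr => i _; rewrite oddM oddX ob orbT andbT.
Qed.

(** Grouping equal digits lets the digit sum be read off from multiplicities alone. *)
Lemma sumn_count_mem (b : nat) (s : seq nat) :
  all (fun d => d < b) s -> sumn s = \sum_(d < b) d * count_mem (val d) s.
Proof.
elim: s => [|x s IH] /=; first by rewrite big1 // => d _; rewrite muln0.
case/andP=> xb /IH ->.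
rewrite (eq_bigr (fun d : 'I_b => d * (x == d) + d * count_mem (val d) s));
  last by move=> d _; rewrite mulnDr.
rewrite big_split /=; congr (_ + _).
rewrite (bigD1 (Ordinal xb)) //= eqxx muln1 big1 ?addn0 // => d.
by rewrite -val_eqE eq_sym /= => /negbTE ->; rewrite muln0.
Qed.

Lemma odd_bin2 (b : nat) : b = 3 %[mod 4] -> odd 'C(b, 2).
Proof.
(* With [b = 4k + 3], the binomial is [(4k + 3)(2k + 1)], a product of odd factors; [.*2] makes
   these parities visible to [odd_double]. *)
move=> hb; have -> : b = (b %/ 4 * 2).*2 + 3 by rewrite {1}(divn_eq b 4) hb; lia.
set k := b %/ 4.
have -> : 'C((k * 2).*2 + 3, 2) = ((k * 2).*2 + 3) * (k.*2 + 1).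
  by rewrite bin2; apply: double_inj; rewrite even_halfK; lia.
by rewrite oddM !oddD !odd_double.
Qed.

(** The digit 0 adds nothing to the digit sum, so a condition on nonzero digits covers the
    pandigital and penholodigital cases together. *)
Lemma odd_nonzero_digits_once (b N : nat) :
    1 < b -> b = 3 %[mod 4] -> 0 < N ->
    (forall d, 0 < d < b -> count_mem d (digits b N) = 1) ->
  odd N.
Proof.
move=> b1 b4 N0 cnt; have repr := digitsP b1 N0.
have ob : odd b by lia.
have [ltb _ _] := repr.
rewrite (odd_base_repr _ _ _ ob repr) (sumn_count_mem _ _ ltb).
rewrite (eq_bigr (fun d : 'I_b => val d)) => [|[[|d] db] _] //.
  by rewrite -(big_mkord xpredT id) bin2_sum odd_bin2.
by rewrite cnt ?muln1.
Qed.

Theorem corollary3 (b : nat) (hb : 2 <= b) (hb4 : b = 3 %[mod 4]) :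
  (~ exists N : nat, strict_pandigital b N /\ oblong N) /\
  (~ exists N : nat, strict_penholodigital b N /\ oblong N).
Proof.
split=> -[N [dig /oblong_even/negP]]; apply.
- case: dig => N0 cnt.
  by apply: (odd_nonzero_digits_once b) => // d /andP[_]; apply: cnt.
- case: dig => N0 _ cnt.
  exact: (odd_nonzero_digits_once b).
Qed.
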